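(* Let $dX_t=\mu_t\,dt+\sigma_t\,dB_t$ on $[0,T]$, where $(\mu,\sigma)$ satisfies the non-leverage condition, the moment bound, and the scaling condition with $\gamma=1$, some function $L$, and $C_1(r,s)=\frac12(|r|+|s|-|r-s|)$. Fix $\tau\in(0,T)$. For an admissible kernel $K$, consider the first order approximation of the MSE of the kernel estimator with its optimal bandwidth, $$\mathrm{MSE}^{a,opt}_n(K)=2\,n^{-1/2}\Big(2T\,\mathbb E[\sigma_\tau^4]\int K^2(x)dx\Big)^{1/2}\Big(L(\tau)\iint K(x)K(y)C_1(x,y)dxdy\Big)^{1/2}.$$ Then, among all admissible kernels $K$, $\mathrm{MSE}^{a,opt}_n(K)$ is minimized by the exponential kernel $$K^{opt}(x)=\tfrac12e^{-|x|},\qquad x\in\mathbb R.$$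
   Context: Setting. On a complete filtered probability space $(\Omega,\mathscr F,\mathbb F=\{\mathscr F_t\}_{t\ge0},\mathbb P)$, $\mu,\sigma$ are $\mathbb F$-adapted processes and $B$ is a standard Brownian motion adapted to $\mathbb F$. $X$ is observed at $t_i=iT/n$; $\Delta=T/n$; the kernel estimator of $\sigma^2_\tau$ is $\sum_{i=1}^nK_h(t_{i-1}-\tau)(X_{t_i}-X_{t_{i-1}})^2$ with $K_h(x)=K(x/h)/h$. The first order approximation of its MSE is $2\frac{\Delta}{h}\mathbb E[\sigma_\tau^4]\int K^2(x)dx+hL(\tau)\iint K(x)K(y)C_1(x,y)dxdy$, and $\mathrm{MSE}_n^{a,opt}(K)$ is its minimum over $h>0$. Non-leverage condition: $(\mu,\sigma)$ is independent of $B$. Moment bound: there is $M_T>1$ with $\mathbb E[\mu_t^4+\sigma_t^4]<M_T$ for all $t\in[0,T]$. Scaling condition (for $\gamma=1$): $L$ is a nonnegative function of $t$ and $V_t=\sigma_t^2$ satisfies, for each $t\in(0,T)$, $\mathbb E[(V_{t+r}-V_t)(V_{t+s}-V_t)]=L(t)C_1(r,s)+o((r^2+s^2)^{1/2})$ as $r,s\to0$. Admissible kernel: $K:\mathbb R\to\mathbb R$ such that (1) $\int K(x)dx=1$; (2) $K$ is Lipschitz and piecewise $C^1$ on its support $(A,B)$, where $-\infty\le A<0<B\le\infty$; (3) $\int|K(x)||x| dx<\infty$, $K(x)x^{2}\to0$ as $|x|\to\infty$, $\int|K'(x)|dx<\infty$, and the total variation of $|K'|$ over $(-\infty,\infty)$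 is finite; (4) $\iint K(x)K(y)C_1(x,y)dxdy>0$. *)

(* Defs.v *)
From HB Require Import structures.
From mathcomp Require Import all_boot all_order all_algebra.
From mathcomp Require Import all_classical all_reals all_analysis.

Set Implicit Arguments.
Unset Strict Implicit.
Unset Printing Implicit Defensive.

Import Order.TTheory GRing.Theory Num.Theory.
Import numFieldNormedType.Exports.

Local Open Scope classical_set_scope.
Local Open Scope ring_scope.

Section stochastic_basis.
Context {R : realType} {d : measure_display} {Omega : measurableType d}.
Implicit Types (P : probability Omega R) (F : R -> set (set Omega)).
Implicit Types (G H : set (set Omega)) (Y : R -> Omega -> R) (xi : Omega -> R).

(* Processes and filtrations are indexed by all of R, but only the indices
   t >= 0 are ever constrained. *)

Definition complete_filtration P F : Prop :=
  [/\ forall t, 0 <= t -> sigma_algebra setT (F t),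
      forall t, 0 <= t -> F t `<=` measurable,
      forall s t, 0 <= s -> s <= t -> F s `<=` F t,
      measure_is_complete P
    & forall t, 0 <= t -> P.-negligible `<=` F t].

Definition measurable_wrt G xi : Prop :=
  forall A : set R, measurable A -> G (xi @^-1` A).

Definition adapted F Y : Prop :=
  forall t, 0 <= t -> measurable_wrt (F t) (Y t).

Definition jointly_measurable (T : R) Y : Prop :=
  measurable_fun (`[0, T]%classic `*` [set: Omega])
    (fun p : measurableTypeR R * Omega => Y p.1 p.2).

Definition independent_systems P G H : Prop :=
  forall A B, G A -> H B -> P (A `&` B) = (P A * P B)%E.

Definition process_events Y : set (set Omega) :=
  \bigcup_(t in [set t : R | 0 <= t])
    preimage_set_system setT (Y t) (@measurable _ (measurableTypeR R)).

(* Independence of the sigma-algebras generated by the pair (mu, sigma) and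
   by B. *)
Definition non_leverage P (mu sigma B : R -> Omega -> R) : Prop :=
  independent_systems P
    <<s process_events mu `|` process_events sigma >> <<s process_events B >>.

(* Standard Brownian motion relative to the filtration F: besides being adapted,
   the increments after time s are independent of F s.  The second argument of
   [normal_prob] is the standard deviation. *)
Definition brownian_motion P F (B : R -> Omega -> R) : Prop :=
  [/\ adapted F B,
      {ae P, forall w, B 0 w = 0},
      {ae P, forall w, {within `[0, +oo[%classic, continuous (B ^~ w)}},
      forall s t, 0 <= s -> s < t ->
        independent_systems P (F s)
          (preimage_set_system setT (fun w => B t w - B s w)
             (@measurable _ (measurableTypeR R)))
    & forall s t, 0 <= s -> s < t -> forall A : set R, measurable A ->
        P ((fun w => B t w - B s w) @^-1` A) =
        normal_prob 0 (Num.sqrt (t - s)) A].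

(* The simple process
   s |-> sum_(i < m) xi_i 1_{]t_i, t_(i+1)]}(s). *)
Record simple_process := SimpleProcess {
  sp_size : nat ;
  sp_time : nat -> R ;
  sp_val : nat -> Omega -> R }.

Definition simple_adapted F (phi : simple_process) : Prop :=
  0 <= sp_time phi 0 /\
  forall i, (i < sp_size phi)%N ->
    [/\ sp_time phi i <= sp_time phi i.+1,
        measurable_wrt (F (sp_time phi i)) (sp_val phi i)
      & exists c : R, forall w, `|sp_val phi i w| <= c].

Definition sp_eval (phi : simple_process) (s : R) (w : Omega) : R :=
  \sum_(i < sp_size phi) sp_val phi i w *
    \1_(`]sp_time phi i, sp_time phi i.+1]%classic) s.

Definition sp_integral (phi : simple_process) (B : R -> Omega -> R)
    (t : R) (w : Omega) : R :=
  \sum_(i < sp_size phi) sp_val phi i w *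
    (B (Num.min (sp_time phi i.+1) t) w - B (Num.min (sp_time phi i) t) w).

(* xi is (a version of) the Ito integral of sigma against B over [0, t]: the
   L^2(P) limit of the integrals of adapted simple processes converging to
   sigma in L^2([0, t] x Omega). *)
Definition is_ito_integral P F (B sigma : R -> Omega -> R) (t : R) xi : Prop :=
  measurable_wrt (F t) xi /\
  exists phi : nat -> simple_process,
    [/\ forall k, simple_adapted F (phi k),
        (\int[P]_w \int[@lebesgue_measure R]_(s in `[0%R, t])
           ((sp_eval (phi k) s w - sigma s w) ^+ 2)%:E)%E @[k --> \oo] --> 0%E
      & (\int[P]_w ((sp_integral (phi k) B t w - xi w) ^+ 2)%:E)%E @[k --> \oo]
          --> 0%E].

(* dX_t = mu_t dt + sigma_t dB_t on [0, T]. *)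
Definition ito_process P F (T : R) (B mu sigma X : R -> Omega -> R) : Prop :=
  [/\ jointly_measurable T mu, jointly_measurable T sigma, adapted F X,
      {ae P, forall w, {within `[0, T]%classic, continuous (X ^~ w)}} /\
      {ae P, forall w, (@lebesgue_measure R).-integrable `[0, T]%classic
                         (fun s => (mu s w)%:E)}
    & exists2 I : R -> Omega -> R,
        forall t, 0 <= t <= T -> is_ito_integral P F B sigma t (I t)
      & forall t, 0 <= t <= T ->
          {ae P, forall w, X t w =
             X 0 w + \int[@lebesgue_measure R]_(s in `[0, t]) mu s w + I t w}].

Definition moment_bound P (T : R) (mu sigma : R -> Omega -> R) : Prop :=
  exists2 M : R, 1 < M &
    forall t, 0 <= t <= T ->
      ('E_P[(fun w => mu t w ^+ 4 + sigma t w ^+ 4)%R] < M%:E)%E.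

Definition C1 (r s : R) : R := 2^-1 * (`|r| + `|s| - `|r - s|).

Definition scaling_condition P (T : R) (sigma : R -> Omega -> R)
    (L : R -> R) : Prop :=
  let V := fun t w => sigma t w ^+ 2 in
  (forall t, 0 < t < T -> 0 <= L t) /\
  forall t, 0 < t < T ->
    (fun p : R * R =>
       fine ('E_P[(fun w => (V (t + p.1) w - V t w) * (V (t + p.2) w - V t w))%R])
       - L t * C1 p.1 p.2)
    =o_ ((0, 0) : R * R) (fun p : R * R => Num.sqrt (p.1 ^+ 2 + p.2 ^+ 2)).

End stochastic_basis.

Section kernels.
Context {R : realType}.
Implicit Types (K f : R -> R) (A B : \bar R).

Local Notation leb := (@lebesgue_measure R).

Definition open_itv A B : set R := [set x | (A < x%:E < B)%E].

(* C^1 off a finite set, with one-sided limits of the derivative there. *)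
Definition piecewise_C1 (D : set R) f : Prop :=
  exists2 s : seq R,
    forall x, D x -> x \notin s ->
      derivable f x 1 /\ {for x, continuous (derive1 f)}
  & forall x, D x -> x \in s ->
      cvg (derive1 f y @[y --> x^'+]) /\ cvg (derive1 f y @[y --> x^'-]).

Definition line_total_variation f : \bar R :=
  ereal_sup [set total_variation p.1 p.2 f | p in [set: R * R]].

Definition sq_int K : R := \int[leb]_x (K x ^+ 2).

Definition C1_int K : R := \int[leb]_x \int[leb]_y (K x * K y * C1 x y).

(* The support is the closure of {K != 0}, so K is not constrained at the
   endpoints A and B themselves: it may jump there, as the uniform kernel does.
   [derive1 K] takes a junk value at the finitely many points where K is not
   differentiable; this affects neither the integrability of K' nor the
   finiteness of the total variation of |K'|. *)
Record admissible_kernel K : Prop := {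
  ak_integrable : leb.-integrable setT (EFin \o K) ;
  ak_mass : \int[leb]_x K x = 1 ;
  ak_support : exists A B,
    [/\ (A < 0 < B)%E,
        closure [set x | K x != 0] = closure (open_itv A B),
        [lipschitz K x | x in open_itv A B]
      & piecewise_C1 (open_itv A B) K] ;
  ak_moment : leb.-integrable setT (fun x => (`|K x| * `|x|)%:E) ;
  ak_decay_pinfty : K x * x ^+ 2 @[x --> +oo] --> 0 ;
  ak_decay_ninfty : K x * x ^+ 2 @[x --> -oo] --> 0 ;
  ak_deriv_integrable : leb.-integrable setT (EFin \o derive1 K) ;
  ak_deriv_variation : (line_total_variation (fun x => `|derive1 K x|)%R < +oo)%E ;
  ak_C1_int_gt0 : 0 < C1_int K }.

Definition exp_kernel (x : R) : R := 2^-1 * expR (- `|x|).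

End kernels.

Section mse.
Context {R : realType} {d : measure_display} {Omega : measurableType d}.
Variables (P : probability Omega R) (sigma : R -> Omega -> R) (L : R -> R).
Variables (T : R) (n : nat) (tau : R).
Implicit Types (K : R -> R) (h : R).

Definition sigma4_mean : R := fine ('E_P[(fun w => sigma tau w ^+ 4)%R]).

(* First order approximation, with bandwidth h and mesh T / n, of the MSE of
   sum_(1 <= i <= n) K_h(t_(i-1) - tau) (X_(t_i) - X_(t_(i-1)))^2
   as an estimator of sigma_tau^2. *)
Definition mse_a K h : R :=
  2 * (T / n%:R / h) * sigma4_mean * sq_int K + h * L tau * C1_int K.

Definition mse_a_opt K : R := inf [set mse_a K h | h in [set h | 0 < h]].

End mse.

(* Main.v *)
(* With T(u) the integral of K beyond u (away from the origin), Fubini gives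
   C1_int K = int T^2.  For every a > 0, comparing K with the Laplace density
   D = (a/2) e^(-a|x|), whose T is E/2 with E = e^(-a|x|), yields
     int K^2 + a^2 int T^2 >= 2 int K D + a^2 int T E - int D^2 - (a^2/4) int E^2,
   and the Euler-Lagrange equation of D makes the right-hand side equal to a/2
   for every K of mass 1.  Taking a = 1 / (4 C1_int K) gives
   sq_int K * C1_int K >= 1/16, with equality for the exponential kernel. *)

Require Import Defs.
From HB Require Import structures.
From mathcomp Require Import all_boot all_order all_algebra.
From mathcomp Require Import all_classical all_reals all_analysis.
From mathcomp Require Import ring lra.

Set Implicit Arguments.
Unset Strict Implicit.
Unset Printing Implicit Defensive.

Import Order.TTheory GRing.Theory Num.Theory.
Import numFieldNormedType.Exports.
Import measurable_realfun.

Local Open Scope classical_set_scope.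
Local Open Scope ring_scope.

(** * The form [C1] as an overlap of intervals *)

Section between.
Context {R : realType}.
Local Notation leb := (@lebesgue_measure R).

(* [between x] is the indicator of the interval from 0 to x; on the negative
   side the endpoint 0 is left out, so that [between x * between y = 0] when x
   and y have opposite signs. *)
Definition between (x u : R) : R := (if 0 <= u then u < x else x < u)%:R.

Lemma between_ge0 x u : 0 <= between x u.
Proof. by rewrite /between; case: ifP => _; exact: ler0n. Qed.

Lemma between_le1 x u : between x u <= 1.
Proof. by rewrite /between lern1 leq_b1. Qed.

Lemma measurable_between :
  measurable_fun setT (fun p : measurableTypeR R * measurableTypeR R => between p.1 p.2).
Proof.
have -> : (fun p : measurableTypeR R * measurableTypeR R => between p.1 p.2) =
    (fun p => if 0 <= p.2 then if p.2 < p.1 then 1 else 0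
              else if p.1 < p.2 then 1 else 0).
  by apply/funext => p; rewrite /between; do ![case: ifP => //].
apply: measurable_fun_ifT; first exact: measurable_fun_ler.
- by apply: measurable_fun_ifT => //; exact: measurable_fun_ltr.
- by apply: measurable_fun_ifT => //; exact: measurable_fun_ltr.
Qed.

Lemma betweenE x : between x =
  \1_[set` (if 0 <= x then `[0, x[ else `]x, 0[)%R : interval R].
Proof.
apply/funext => u; rewrite /between indicE; congr (nat_of_bool _)%:R.
by rewrite mem_setE; case: (leP 0 x) => x0; rewrite in_itv /=;
  case: (leP 0 u) => u0 //=; rewrite ?andbT ?andbF //; apply/negbTE; rewrite -leNgt; lra.
Qed.

Lemma integral_between x : (\int[leb]_u (between x u)%:E = `|x|%:E)%E.
Proof.
rewrite betweenE integral_indic// setIT.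
case: (leP 0 x) => x0; rewrite [LHS]lebesgue_measure_itv /= lte_fin.
- case: (ltP 0 x) => x1; first by rewrite -EFinB subr0 ger0_norm.
  by have -> : x = 0; [lra|rewrite normr0].
- by rewrite x0 -EFinB sub0r ltr0_norm.
Qed.

(** Two intervals issued from 0 intersect in the shorter one if they lie on the same side, and are
    disjoint otherwise; the disjoint case is encoded by [between 0], which vanishes identically. *)
Lemma between_mul x y u : between x u * between y u =
  between (if 0 <= x then if 0 <= y then Num.min x y else 0
           else if 0 <= y then 0 else Num.max x y) u.
Proof.
rewrite /between -natrM mulnb; congr (nat_of_bool _)%:R.
case: (leP 0 x) => x0; case: (leP 0 y) => y0;
  case: ifPn; rewrite -?ltNge => u0; case: (leP x y) => xy; apply/idP/idP => [/andP[? ?]|?];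
  try (apply/andP; split); lra.
Qed.

(** The overlap has length min(|x|, |y|) for equal signs and 0 for opposite signs, which is [C1],
    the covariance of two-sided Brownian motion. This Gram representation is what turns the
    quadratic form of [C1] into the integral of a square. *)
Lemma Rintegral_between_mul x y :
  \int[leb]_u (between x u * between y u) = C1 x y.
Proof.
under eq_Rintegral do rewrite between_mul.
rewrite /Rintegral integral_between /= /C1.
case: (leP 0 x) => x0; case: (leP 0 y) => y0;
  rewrite ?(ger0_norm x0) ?(ltr0_norm x0) ?(ger0_norm y0) ?(ltr0_norm y0).
- case: (leP x y) => xy; first by rewrite ger0_norm // ler0_norm; lra.
  by rewrite ger0_norm // gtr0_norm; lra.
- by rewrite normr0 gtr0_norm; lra.
- by rewrite normr0 ltr0_norm; lra.
- case: (leP x y) => xy; first by rewrite ltr0_norm // ler0_norm; lra.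
  by rewrite ltr0_norm // gtr0_norm; lra.
Qed.

End between.

(** * Tail integrals and their pairing with bounded functions *)

Section tail.
Context {R : realType}.
Local Notation leb := (@lebesgue_measure R).
Implicit Types (K phi : R -> R).

Lemma EFin_Rintegral K : leb.-integrable setT (EFin \o K) ->
  ((\int[leb]_x K x)%:E = \int[leb]_x (K x)%:E)%E.
Proof. by move=> iK; rewrite /Rintegral fineK//; exact: integrable_fin_num. Qed.

Lemma measurable_betweenr x : measurable_fun [set: R] (between x).
Proof. exact: measurableT_comp measurable_between (measurable_pair1 x). Qed.

Lemma measurable_betweenl u : measurable_fun [set: R] (between ^~ u).
Proof. exact: measurableT_comp measurable_between (measurable_pair2 u). Qed.

Lemma integrable_between x : leb.-integrable setT (EFin \o between x).
Proof.
apply/integrableP; split.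
  by apply/measurable_EFinP; exact: measurable_betweenr.
under eq_integral do rewrite /= ger0_norm ?between_ge0//.
by rewrite integral_between ltry.
Qed.

(** The T of the overview: the integral of [K] over y > u when u >= 0, and over y < u when u < 0. *)
Definition tail K (u : R) : R := \int[leb]_y (K y * between y u).

Lemma integrable_tail_integrand K u : leb.-integrable setT (EFin \o K) ->
  leb.-integrable setT (fun y => (K y * between y u)%:E).
Proof.
move=> iK; apply: (le_integrable _ _ _ iK) => //.
  apply/measurable_EFinP; apply: measurable_funM.
    by apply/measurable_EFinP; exact: measurable_int iK.
  exact: measurable_betweenl.
move=> y _ /=; rewrite lee_fin normrM ler_piMr// ger0_norm ?between_ge0//.
exact: between_le1.
Qed.

(** This uniform bound allows [tail K] itself to serve as the bounded function [phi] below. *)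
Lemma normr_tail K u : leb.-integrable setT (EFin \o K) ->
  `|tail K u| <= \int[leb]_y `|K y|.
Proof.
move=> iK; apply: (le_trans (le_normr_Rintegral _ (integrable_tail_integrand u iK))) => //.
apply: le_Rintegral => //.
- exact: integrable_norm (integrable_tail_integrand u iK).
- exact: integrable_norm.
move=> y _ /=; rewrite normrM ler_piMr// ger0_norm ?between_ge0//.
exact: between_le1.
Qed.

Section pairing.
Variables (K phi : R -> R) (M : R).
Hypothesis iK : leb.-integrable setT (EFin \o K).
Hypothesis iKx : leb.-integrable setT (fun x => (`|K x| * `|x|)%:E).
Hypothesis mphi : measurable_fun setT phi.
Hypothesis bphi : forall u, `|phi u| <= M.

Let f (p : measurableTypeR R * measurableTypeR R) : \bar R :=
  (K p.2 * (between p.2 p.1 * phi p.1))%:E.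

Let mf : measurable_fun setT f.
Proof.
have mK : measurable_fun setT K by apply/measurable_EFinP; exact: measurable_int iK.
apply/measurable_EFinP; apply: measurable_funM.
  exact: measurableT_comp mK measurable_snd.
apply: measurable_funM; last exact: measurableT_comp mphi measurable_fst.
exact: measurableT_comp measurable_between
  (@measurable_swap _ _ (measurableTypeR R) (measurableTypeR R)).
Qed.

Lemma integrable_between_mul x :
  leb.-integrable setT (fun u => (between x u * phi u)%:E).
Proof.
have M0 : 0 <= M := le_trans (normr_ge0 _) (bphi 0).
apply: (le_integrable _ _ _ (integrableZl _ M (integrable_between x))) => //.
  by apply/measurable_EFinP; apply: measurable_funM => //; exact: measurable_betweenr.
move=> u _ /=; rewrite lee_fin !normrM mulrC (ger0_norm M0).
by rewrite ler_wpM2r.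
Qed.

(** Since [between x] has mass |x|, integrating |f| in its first variable leaves at most M |K x|
    |x|, so the first moment of [K] gives integrability on the plane. *)
Let intf : (leb \x leb)%E.-integrable setT f.
Proof.
have M0 : 0 <= M := le_trans (normr_ge0 _) (bphi 0).
apply/integrable21ltyP => //.
apply: (@le_lt_trans _ _ (\int[leb]_x (M%:E * (`|K x| * `|x|)%:E))%E); last first.
  by rewrite integralZl// lte_mul_pinfty ?lee_fin//; exact: integrable_lty.
apply: ge0_le_integral => //.
- by move=> x _; exact: integral_ge0.
- by apply: (measurable_fun_fubini_tonelli_G (abse \o f)) => //=; apply: measurableT_comp => //.
- by apply: measurable_funeM; exact: measurable_int iKx.
move=> x _; rewrite -EFinM mulrA EFinM -integral_between -integralZl//; last first.
  exact: integrable_between.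
apply: ge0_le_integral => //.
- apply: measurableT_comp => //; apply: measurableT_comp mf _.
  exact: measurable_pair2.
- by apply: measurable_funeM; exact/measurable_int/integrable_between.
move=> u _; rewrite /= lee_fin !normrM (ger0_norm (between_ge0 _ _)).
by rewrite (mulrC M) -mulrA ler_wpM2l// mulrC ler_wpM2r// between_ge0.
Qed.

Let fubini_FE u : (\int[leb]_y f (u, y))%E = (phi u * tail K u)%:E.
Proof.
rewrite EFinM EFin_Rintegral; last exact: integrable_tail_integrand.
rewrite -integralZl//; last exact: integrable_tail_integrand.
by apply: eq_integral => y _; rewrite -EFinM; congr EFin; rewrite /=; ring.
Qed.

Lemma integrable_tail_mul : leb.-integrable setT (fun u => (phi u * tail K u)%:E).
Proof.
have := integrable_fubini_F intf; apply: eq_integrable => // u _.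
exact: fubini_FE.
Qed.

(** Fubini moves a pairing with the tail onto [K]. It is applied with [phi] equal to [tail K], to
    [between x] and to [laplace a]. *)
Lemma Rintegral_tail_mul : \int[leb]_u (phi u * tail K u) =
  \int[leb]_y (K y * \int[leb]_u (between y u * phi u)).
Proof.
transitivity (fine (\int[leb]_u \int[leb]_y f (u, y))%E).
  by congr fine; apply: eq_integral => u _; rewrite fubini_FE.
transitivity (fine (\int[leb]_y \int[leb]_u f (u, y))%E).
  congr fine; exact: Fubini intf.
congr fine; apply: eq_integral => y _.
rewrite EFinM EFin_Rintegral; last exact: integrable_between_mul.
rewrite -integralZl//; exact: integrable_between_mul.
Qed.

End pairing.
End tail.

(** * Laplace functions: masses, tails and moments *)

Section laplace.
Context {R : realType}.
Local Notation leb := (@lebesgue_measure R).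

(** The E of the overview. The normalising factor a/2 is left out, so that squaring merely doubles
    the rate. *)
Definition laplace (a x : R) : R := expR (- (a * `|x|)).

Lemma continuous_laplace a : continuous (laplace a).
Proof.
move=> x; apply: continuous_comp; last exact: continuous_expR.
by apply: continuousN; apply: continuousM; [exact: cst_continuous|exact: norm_continuous].
Qed.

Lemma measurable_laplace a : measurable_fun [set: R] (laplace a).
Proof. exact: continuous_measurable_fun (@continuous_laplace a). Qed.

Lemma laplace_ge0 a x : 0 <= laplace a x.
Proof. exact: expR_ge0. Qed.

Lemma laplace_le1 a x : 0 <= a -> laplace a x <= 1.
Proof. by move=> a0; rewrite expR_le1 oppr_le0 mulr_ge0. Qed.

Lemma laplaceN a x : laplace a (- x) = laplace a x.
Proof. by rewrite /laplace normrN. Qed.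

Lemma laplace_sqr a x : laplace a x ^+ 2 = laplace (2 * a) x.
Proof. by rewrite /laplace -expRM_natl; congr expR; ring. Qed.

Section pos.
Variable a : R.
Hypothesis a0 : 0 < a.

Lemma integral_laplace_itvy u : 0 <= u ->
  (\int[leb]_(x in `[u, +oo[) (laplace a x)%:E = (a^-1 * laplace a u)%:E)%E.
Proof.
move=> u0.
rewrite (@ge0_continuous_FTC2y _ _ (fun x => - (a^-1 * expR (- (a * x)))) _ 0) //.
- by rewrite -EFinB sub0r opprK /laplace ger0_norm.
- by move=> x _; exact: laplace_ge0.
- exact/continuous_subspaceT/continuous_laplace.
- rewrite -[X in _ --> X]oppr0 -[X in - X](mulr0 a^-1).
  apply: cvgN; apply: cvgMl_tmp.
  apply: (cvg_comp _ _ _ (@cvgr_expR R)) => /=.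
  by apply: gt0_cvgMry => //; exact: cvg_id.
- apply: cvg_at_right_filter; apply: cvgN; apply: cvgMl_tmp.
  apply: continuous_comp; last exact: continuous_expR.
  by apply: cvgN; apply: cvgMl_tmp.
- move=> x; rewrite in_itv/= andbT => /ltW/(le_trans u0) x0.
  rewrite derive1E derive_val /laplace ger0_norm// /GRing.scale/=.
  by field; exact: lt0r_neq0.
Qed.

Lemma integral_laplace : (\int[leb]_x (laplace a x)%:E = (2 / a)%:E)%E.
Proof.
rewrite ge0_symfun_integralT.
- by rewrite -set_itvcy integral_laplace_itvy// -EFinM /laplace normr0 mulr0 oppr0 expR0 mulr1.
- exact: laplace_ge0.
- exact: continuous_laplace.
- by move=> x /=; rewrite laplaceN.
Qed.

Lemma integrable_laplace : leb.-integrable setT (EFin \o laplace a).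
Proof.
apply/integrableP; split; first by apply/measurable_EFinP; exact: measurable_laplace.
under eq_integral do rewrite /= ger0_norm ?laplace_ge0//.
by rewrite integral_laplace ltry.
Qed.

Lemma Rintegral_laplace : \int[leb]_x laplace a x = 2 / a.
Proof. by rewrite /Rintegral integral_laplace. Qed.

Let integrable_laplaceS (A : set R) : measurable A ->
  leb.-integrable A (EFin \o laplace a).
Proof. by move=> mA; exact: integrableS integrable_laplace. Qed.

Let Rintegral_laplace_itvy u : 0 <= u ->
  \int[leb]_(x in `]u, +oo[) laplace a x = a^-1 * laplace a u.
Proof.
move=> u0; rewrite Rintegral_itv_obnd_cbnd; last exact: integrable_laplaceS.
by rewrite /Rintegral integral_laplace_itvy.
Qed.

Let Rintegral_laplace_itvNy u : u <= 0 ->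
  \int[leb]_(x in `]-oo, u[) laplace a x = a^-1 * laplace a u.
Proof.
move=> u0; rewrite Rintegral_itv_bndo_bndc; last exact: integrable_laplaceS.
rewrite /Rintegral -[u in `]-oo, u]]opprK ge0_integration_by_substitutionNy.
- under eq_integral do rewrite /= laplaceN.
  by rewrite integral_laplace_itvy ?oppr_ge0//= laplaceN.
- exact/continuous_subspaceT/continuous_laplace.
- by move=> x _; exact: laplace_ge0.
Qed.

(** An exponential is proportional to its own tail; for a = 1 this makes both functionals of the
    exponential kernel the same integral. *)
Lemma tail_laplace u : tail (laplace a) u = a^-1 * laplace a u.
Proof.
have [u0|u0] := leP 0 u.
  rewrite -(Rintegral_laplace_itvy u0) Rintegral_mkcond; apply: eq_Rintegral => y _.
  rewrite /between u0 patchE mem_setE in_itv/= andbT.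
  by case: ifP; rewrite ?mulr1 ?mulr0.
rewrite -(Rintegral_laplace_itvNy (ltW u0)) Rintegral_mkcond; apply: eq_Rintegral => y _.
rewrite /between leNgt u0 patchE mem_setE in_itv/=.
by case: ifP; rewrite ?mulr1 ?mulr0.
Qed.

(** The Euler-Lagrange equation in integrated form: a E(y) + a^2 times this integral is the constant
    a, whatever y is. *)
Lemma Rintegral_between_laplace y :
  \int[leb]_u (between y u * laplace a u) = a^-1 * (1 - laplace a y).
Proof.
have E0 : laplace a 0 = 1 by rewrite /laplace normr0 mulr0 oppr0 expR0.
transitivity (\int[leb]_(u in [set` (if 0 <= y then `[0, y[ else `]y, 0[)%R : interval R])
    laplace a u).
  rewrite [RHS]Rintegral_mkcond; apply: eq_Rintegral => u _.
  by rewrite betweenE patchE indicE; case: (_ \in _); rewrite ?mul1r ?mul0r.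
have [y0|y0] := leP 0 y.
  rewrite Rintegral_itv_bndo_bndc; last exact: integrable_laplaceS.
  have : \int[leb]_(u in `[0, +oo[) laplace a u - \int[leb]_(u in `[0, y]) laplace a u =
      \int[leb]_(u in `]y, +oo[) laplace a u.
    by apply: Rintegral_itvB => //; exact: integrable_laplaceS.
  rewrite Rintegral_laplace_itvy // {1}/Rintegral integral_laplace_itvy//= E0; lra.
have : \int[leb]_(u in `]-oo, 0[) laplace a u - \int[leb]_(u in `]-oo, y]) laplace a u =
    \int[leb]_(u in `]y, 0[) laplace a u.
  by apply: Rintegral_itvB => //; exact: integrable_laplaceS.
rewrite -Rintegral_itv_bndo_bndc; last exact: integrable_laplaceS.
rewrite !Rintegral_laplace_itvNy ?(ltW y0)// E0; lra.
Qed.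

End pos.

(** Half of the rate is spent on absorbing |x|: write E as a square and use 1 + t <= e^t at t =
    a|x|/2. *)
Lemma laplace_norm_le a x : 0 < a ->
  laplace a x * `|x| <= 2 / a * laplace (a / 2) x.
Proof.
move=> a0; have -> : laplace a x = laplace (a / 2) x * laplace (a / 2) x.
  by rewrite /laplace -expRD; congr expR; field.
rewrite -mulrA [leRHS]mulrC ler_wpM2l ?laplace_ge0//.
rewrite /laplace expRN ler_pdivrMl ?expR_gt0//.
have := expR_ge1Dx (a / 2 * `|x|).
rewrite -(ler_pM2r (_ : 0 < 2 / a)) ?divr_gt0//.
have -> : (1 + a / 2 * `|x|) * (2 / a) = 2 / a + `|x| by field; exact: lt0r_neq0.
by move=> H; apply: le_trans H; rewrite lerDr divr_ge0// ltW.
Qed.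

Lemma integrable_laplace_moment a : 0 < a ->
  leb.-integrable setT (fun x => (laplace a x * `|x|)%:E).
Proof.
move=> a0; have i2 : leb.-integrable setT (EFin \o laplace (a / 2)).
  by apply: integrable_laplace; rewrite divr_gt0.
apply: (le_integrable _ _ _ (integrableZl _ (2 / a) i2)) => //.
  apply/measurable_EFinP; apply: measurable_funM; first exact: measurable_laplace.
  exact: normr_measurable.
move=> x _ /=; rewrite lee_fin (ger0_norm (mulr_ge0 (laplace_ge0 a x) (normr_ge0 x))).
by apply: le_trans (ler_norm _); exact: laplace_norm_le.
Qed.

End laplace.

(** * The lower bound 1/16 for the product of the two functionals *)

Section C1_form.
Context {R : realType}.
Local Notation leb := (@lebesgue_measure R).
Implicit Types K : R -> R.

Lemma normr_C1_le (x y : R) : `|C1 x y| <= `|x|.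
Proof.
rewrite /C1 ler_norml; have := ler_normD (x - y) y; have := ler_normD x (- y).
have := ler_normB x (x - y); rewrite normrN subrK opprB addrC subrK; lra.
Qed.

(** Pairing with the constant function 1 makes the tail integrable by Fubini, hence measurable. *)
Lemma measurable_tail K : leb.-integrable setT (EFin \o K) ->
  leb.-integrable setT (fun x => (`|K x| * `|x|)%:E) ->
  measurable_fun setT (tail K).
Proof.
move=> iK iKx.
have b1 (u : R) : `|cst (1 : R) u| <= 1 by rewrite normr1.
have /measurable_int/measurable_EFinP :=
  integrable_tail_mul iK iKx (@measurable_cst _ _ _ _ setT (1 : R)) b1.
by apply: eq_measurable_fun => u _; rewrite mul1r.
Qed.

Lemma integrable_sqr_tail K : leb.-integrable setT (EFin \o K) ->
  leb.-integrable setT (fun x => (`|K x| * `|x|)%:E) ->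
  leb.-integrable setT (fun u => (tail K u ^+ 2)%:E).
Proof.
move=> iK iKx.
have := integrable_tail_mul iK iKx (measurable_tail iK iKx) (fun u => normr_tail u iK).
by apply: eq_integrable => // u _; rewrite expr2.
Qed.

(** The pairing formula is used twice: with [tail K] to free one factor [K x], then with [between x]
    to free the other. What remains is the overlap integral, equal to [C1]. *)
Lemma C1_int_tail K : leb.-integrable setT (EFin \o K) ->
  leb.-integrable setT (fun x => (`|K x| * `|x|)%:E) ->
  C1_int K = \int[leb]_u (tail K u ^+ 2).
Proof.
move=> iK iKx; under [RHS]eq_Rintegral do rewrite expr2.
rewrite (Rintegral_tail_mul iK iKx (measurable_tail iK iKx) (fun u => normr_tail u iK)).
apply: eq_Rintegral => x _.
have b1 u : `|between x u| <= 1 by rewrite ger0_norm ?between_ge0 ?between_le1.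
rewrite (Rintegral_tail_mul iK iKx (measurable_betweenr x) b1) -RintegralZl//.
  by apply: eq_Rintegral => y _; rewrite Rintegral_between_mul mulrA;
    congr (_ * _); rewrite /C1 (distrC x) (addrC `|x|).
under eq_fun do rewrite Rintegral_between_mul.
apply: (le_integrable _ _ _ iKx) => //.
  apply/measurable_EFinP; apply: measurable_funM.
    by apply/measurable_EFinP; exact: measurable_int iK.
  apply: measurable_funM => //; apply: measurable_funB.
    by apply: measurable_funD => //; exact: normr_measurable.
  by apply: measurableT_comp => //; exact: measurable_funB.
move=> y _ /=; rewrite lee_fin [leLHS]normrM [leRHS]normrM !normr_id.
by rewrite ler_wpM2l// normr_C1_le.
Qed.

(** The integral of (f - g)^2 is nonnegative. The resulting bound is affine in f, so it can be
    evaluated against a fixed comparison function g. *)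
Lemma Rintegral_sqr_ge (f g : R -> R) :
  leb.-integrable setT (fun x => (f x ^+ 2)%:E) ->
  leb.-integrable setT (fun x => (f x * g x)%:E) ->
  leb.-integrable setT (fun x => (g x ^+ 2)%:E) ->
  2 * \int[leb]_x (f x * g x) - \int[leb]_x (g x ^+ 2) <= \int[leb]_x (f x ^+ 2).
Proof.
move=> iff ifg igg.
have i2 : leb.-integrable setT (fun x => (2 * (f x * g x))%:E) by exact: (integrableZl _ 2 ifg).
rewrite -RintegralZl// -RintegralB//; apply: le_Rintegral => //.
  exact: (integrableB _ i2 igg).
move=> x _; rewrite -subr_ge0.
have -> : f x ^+ 2 - (2 * (f x * g x) - g x ^+ 2) = (f x - g x) ^+ 2 by ring.
exact: sqr_ge0.
Qed.

Lemma quadratic_lower_bound K (M a : R) : 0 < a ->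
  leb.-integrable setT (EFin \o K) ->
  leb.-integrable setT (fun x => (`|K x| * `|x|)%:E) ->
  (forall x, `|K x| <= M) -> \int[leb]_x K x = 1 ->
  a / 2 <= sq_int K + a ^+ 2 * C1_int K.
Proof.
move=> a0 iK iKx bK K1.
have mK : measurable_fun setT K by apply/measurable_EFinP; exact: measurable_int iK.
have iKE : leb.-integrable setT (fun x => (K x * laplace a x)%:E).
  apply: (le_integrable _ _ _ iK) => //.
    by apply/measurable_EFinP; apply: measurable_funM => //; exact: measurable_laplace.
  move=> x _ /=; rewrite lee_fin normrM (ger0_norm (laplace_ge0 _ _)) ler_piMr//.
  by rewrite laplace_le1// ltW.
(* Boundedness gives K^2 <= M |K|. *)
have iKK : leb.-integrable setT (fun x => (K x ^+ 2)%:E).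
  apply: (le_integrable _ _ _ (integrableZl _ M iK)) => //.
    by apply/measurable_EFinP; exact: measurable_funX.
  move=> x _ /=; rewrite lee_fin expr2 !normrM ler_wpM2r//.
  exact: le_trans (ler_norm _).
have iEE c : leb.-integrable setT (fun x => ((c * laplace a x) ^+ 2)%:E).
  have := integrableZl measurableT (c ^+ 2) (integrable_laplace (mulr_gt0 (ltr0n _ 2) a0)).
  by apply: eq_integrable => // x _ /=; rewrite exprMn laplace_sqr.
have EE c : \int[leb]_x ((c * laplace a x) ^+ 2) = c ^+ 2 / a.
  under eq_Rintegral do rewrite exprMn laplace_sqr.
  rewrite RintegralZl//; last by apply: integrable_laplace; rewrite mulr_gt0.
  rewrite Rintegral_laplace ?mulr_gt0//; field; exact: lt0r_neq0.
set I := \int[leb]_x (K x * laplace a x).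
have bE u : `|laplace a u| <= 1 by rewrite ger0_norm ?laplace_ge0// laplace_le1// ltW.
have iET := integrable_tail_mul iK iKx (measurable_laplace a) bE.
have ET : \int[leb]_u (laplace a u * tail K u) = a^-1 * (1 - I).
  rewrite (Rintegral_tail_mul iK iKx (measurable_laplace a) bE) -K1 -RintegralB//.
  rewrite -RintegralZl//; last exact: (integrableB _ iK iKE).
  by apply: eq_Rintegral => y _; rewrite Rintegral_between_laplace//; ring.
(* Comparison of [K] with the Laplace density (a/2) E. *)
have Sge : a * I - a / 4 <= sq_int K.
  have iKEa : leb.-integrable setT (fun x => (K x * (a / 2 * laplace a x))%:E).
    have := integrableZl measurableT (a / 2) iKE.
    by apply: eq_integrable => // x _; rewrite -EFinM mulrCA.
  apply: le_trans (Rintegral_sqr_ge iKK iKEa (iEE _)).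
  under eq_Rintegral do rewrite mulrCA.
  rewrite EE RintegralZl// -/I [leRHS](_ : _ = a * I - a / 4)//.
  by field; exact: lt0r_neq0.
(* Comparison of [tail K] with E/2, the tail of that same density. *)
have Cge : a^-1 * (1 - I) - (4 * a)^-1 <= C1_int K.
  have iETa : leb.-integrable setT (fun x => (tail K x * (2^-1 * laplace a x))%:E).
    have := integrableZl measurableT 2^-1 iET.
    by apply: eq_integrable => // x _; rewrite -EFinM [tail K x * _]mulrC mulrA.
  rewrite C1_int_tail//.
  apply: le_trans (Rintegral_sqr_ge (integrable_sqr_tail iK iKx) iETa (iEE _)).
  under eq_Rintegral do rewrite [tail K _ * _]mulrC -mulrA.
  rewrite EE RintegralZl// ET [leRHS](_ : _ = a^-1 * (1 - I) - (4 * a)^-1)//.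
  by field; exact: lt0r_neq0.
(* With the second bound weighted by a^2, the terms in [I] cancel and a - a/4 - a/4 = a/2
   remains. *)
have := lerD Sge (ler_wpM2l (sqr_ge0 a) Cge); apply: le_trans.
rewrite [leRHS](_ : _ = a / 2)//; field; exact: lt0r_neq0.
Qed.

Lemma sq_int_C1_int_ge K (M : R) :
  leb.-integrable setT (EFin \o K) ->
  leb.-integrable setT (fun x => (`|K x| * `|x|)%:E) ->
  (forall x, `|K x| <= M) -> \int[leb]_x K x = 1 -> 0 < C1_int K ->
  16^-1 <= sq_int K * C1_int K.
Proof.
move=> iK iKx bK K1 C0; set C := C1_int K in C0 *.
(* The rate 1/(4C) maximises a C/2 - a^2 C^2, the lower bound for the product; its value there is
   1/8 - 1/16. *)
have a0 : 0 < (4 * C)^-1 by rewrite invr_gt0 mulr_gt0.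
have := ler_wpM2r (ltW C0) (quadratic_lower_bound a0 iK iKx bK K1); rewrite -/C.
have C1 : C != 0 := lt0r_neq0 C0.
have -> : (4 * C)^-1 / 2 * C = 8^-1 by field.
rewrite mulrDl.
have -> : (4 * C)^-1 ^+ 2 * C * C = 16^-1 by field.
lra.
Qed.

End C1_form.

(** * The exponential kernel: functionals and regularity *)

Section exp_kernel.
Context {R : realType}.
Local Notation leb := (@lebesgue_measure R).

Lemma exp_kernelE : @exp_kernel R = (fun x => 2^-1 * laplace 1 x).
Proof. by apply/funext => x; rewrite /exp_kernel /laplace mul1r. Qed.

Lemma integrable_exp_kernel : leb.-integrable setT (EFin \o @exp_kernel R).
Proof. by rewrite exp_kernelE; apply: (integrableZl _ 2^-1 (integrable_laplace _)). Qed.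

Lemma Rintegral_exp_kernel : \int[leb]_x exp_kernel x = 1.
Proof.
rewrite exp_kernelE RintegralZl//; last exact: integrable_laplace.
by rewrite Rintegral_laplace// divr1 mulVf.
Qed.

Lemma integrable_exp_kernel_moment :
  leb.-integrable setT (fun x : R => (`|exp_kernel x| * `|x|)%:E).
Proof.
rewrite exp_kernelE.
have := integrableZl measurableT 2^-1 (integrable_laplace_moment (@ltr01 R)).
apply: eq_integrable => // x _ /=.
by rewrite (ger0_norm (mulr_ge0 _ (laplace_ge0 1 x)))// -EFinM mulrA.
Qed.

Let laplace_sqr_mass : \int[leb]_x ((2^-1 * laplace 1 x) ^+ 2) = 4^-1.
Proof.
under eq_Rintegral do rewrite exprMn laplace_sqr.
rewrite RintegralZl//; last by apply: integrable_laplace; rewrite mulr1.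
by rewrite Rintegral_laplace ?mulr1//; field.
Qed.

Lemma sq_int_exp_kernel : sq_int (@exp_kernel R) = 4^-1.
Proof. by rewrite /sq_int exp_kernelE laplace_sqr_mass. Qed.

(** At rate 1 the exponential kernel is its own tail, so its [C1_int] is its [sq_int]. *)
Lemma C1_int_exp_kernel : C1_int (@exp_kernel R) = 4^-1.
Proof.
rewrite C1_int_tail; [|exact: integrable_exp_kernel|exact: integrable_exp_kernel_moment].
rewrite -laplace_sqr_mass; apply: eq_Rintegral => u _; congr (_ ^+ 2).
have -> : laplace 1 u = tail (laplace 1) u by rewrite tail_laplace// invr1 mul1r.
rewrite exp_kernelE.
rewrite /tail -RintegralZl//; last exact/integrable_tail_integrand/integrable_laplace.
by apply: eq_Rintegral => y _; rewrite mulrA.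
Qed.

(** For a <= b, factor out e^(-a) <= 1 and use 1 - e^(-t) <= t with t = b - a. *)
Lemma ler_dist_expRN (a b : R) : 0 <= a -> 0 <= b ->
  `|expR (- a) - expR (- b)| <= `|a - b|.
Proof.
wlog ab : a b / a <= b.
  move=> H a0 b0; have [ab|/ltW ba] := leP a b; first exact: H.
  by rewrite distrC (distrC a); exact: H.
move=> a0 b0; rewrite (ler0_norm (_ : a - b <= 0)) ?subr_le0//.
rewrite ger0_norm ?subr_ge0 ?ler_expR ?lerN2//.
have -> : expR (- b) = expR (- a) * expR (- (b - a)) by rewrite -expRD; congr expR; ring.
rewrite -[X in X - _]mulr1 -mulrBr.
apply: (@le_trans _ _ (1 * (1 - expR (- (b - a))))).
  by rewrite ler_wpM2r// ?subr_ge0 expR_le1; lra.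
by have := expR_ge1Dx (- (b - a)); lra.
Qed.

Lemma lipschitz_exp_kernel (A : set R) : [lipschitz (@exp_kernel R) x | x in A].
Proof.
rewrite /lipschitz_on; near=> M => -[x y] _ /=.
have : 1 * `|x - y| <= M * `|x - y| by rewrite ler_wpM2r//; near: M; exact: nbhs_pinfty_ge.
apply: le_trans.
rewrite /exp_kernel -mulrBr normrM ger0_norm// mul1r.
have := ler_dist_expRN (normr_ge0 x) (normr_ge0 y); have := ler_dist_dist x y.
have := normr_ge0 (x - y); lra.
Unshelve. all: by end_near. Qed.

Lemma exp_kernel_is_derive (x : R) : x != 0 ->
  is_derive x 1 (@exp_kernel R) (- Num.sg x * exp_kernel x).
Proof.
rewrite neq_lt => /orP[x0|x0].
- apply: (@near_eq_is_derive _ _ _ (fun y => 2^-1 * expR y)).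
    by near=> y; rewrite /exp_kernel ltr0_norm ?opprK//; near: y; exact: lt_nbhsl.
  rewrite ltr0_sg// /exp_kernel ltr0_norm// !opprK mul1r.
  exact: is_deriveZ.
- apply: (@near_eq_is_derive _ _ _ (fun y => 2^-1 * expR (- y))).
    by near=> y; rewrite /exp_kernel gtr0_norm//; near: y; exact: lt_nbhsr.
  rewrite gtr0_sg// /exp_kernel gtr0_norm//.
  apply: is_derive_eq; rewrite /GRing.scale/=; ring.
Unshelve. all: by end_near. Qed.

Lemma derive1_exp_kernel (x : R) : x != 0 ->
  derive1 (@exp_kernel R) x = - Num.sg x * exp_kernel x.
Proof. by move=> /exp_kernel_is_derive H; rewrite derive1E derive_val. Qed.

Let continuous_exp_kernel : continuous (@exp_kernel R).
Proof.
rewrite exp_kernelE => x; apply: cvgMl_tmp; exact: continuous_laplace.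
Qed.

Lemma piecewise_C1_exp_kernel (A : set R) : piecewise_C1 A (@exp_kernel R).
Proof.
(* The cusp at 0 is the exceptional point; the derivative tends to -K(0) on its right and to K(0) on
   its left. *)
exists [:: 0] => x _; rewrite inE => x0.
  split; first by have [] := exp_kernel_is_derive x0.
  rewrite /prop_for /continuous_at derive1_exp_kernel//.
  apply: cvg_trans; last exact: (cvgMl_tmp (a := - Num.sg x) (@continuous_exp_kernel x)).
  apply: near_eq_cvg.
  have [xn|xp] : x < 0 \/ 0 < x by apply/orP; rewrite -neq_lt.
    near=> y; have yn : y < 0 by near: y; exact: lt_nbhsl.
    by rewrite derive1_exp_kernel ?lt_eqF// !ltr0_sg.
  near=> y; have yp : 0 < y by near: y; exact: lt_nbhsr.
  by rewrite derive1_exp_kernel ?gt_eqF// !gtr0_sg.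
rewrite (eqP x0); split; apply/cvg_ex.
  exists (- 1 * exp_kernel 0).
  apply: cvg_trans; last exact: cvg_at_right_filter
    (@cvgMl_tmp _ _ _ _ _ (- 1) _ (@continuous_exp_kernel 0)).
  apply: near_eq_cvg; near=> y.
  have yp : 0 < y by [].
  by rewrite derive1_exp_kernel ?gt_eqF// gtr0_sg.
exists (1 * exp_kernel 0).
apply: cvg_trans; last exact: cvg_at_left_filter
  (@cvgMl_tmp _ _ _ _ _ 1 _ (@continuous_exp_kernel 0)).
apply: near_eq_cvg; near=> y.
have yn : y < 0 by [].
by rewrite derive1_exp_kernel ?lt_eqF// ltr0_sg// opprK.
Unshelve. all: by end_near. Qed.

End exp_kernel.

(** * Admissibility of the exponential kernel *)

Section total_variation.
Context {R : realType}.

(** Along any subdivision the dominating increments of [m] telescope. *)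
Lemma total_variation_dominated (f m : R -> R) a b :
  (forall x y, x < y -> `|f y - f x| <= m y - m x) ->
  (total_variation a b f <= (m b - m a)%:E)%E.
Proof.
move=> fm; apply: ge_ereal_sup => _ [_ [s [/(pathP b) ps /eqP ls] <-] <-].
rewrite lee_fin /variation /=.
have <- : \sum_(0 <= n < size s) (m (nth b (a :: s) n.+1) - m (nth b (a :: s) n)) = m b - m a.
  by rewrite telescope_sumr// -last_nth ls.
rewrite big_nat [leRHS]big_nat; apply: ler_sum => n /andP[_ ns].
by apply: fm; exact: ps.
Qed.

End total_variation.

Section exp_kernel_admissible.
Context {R : realType}.
Local Notation leb := (@lebesgue_measure R).

Lemma exp_kernel_decay : exp_kernel x * x ^+ 2 @[x --> +oo] --> (0 : R).
Proof.
(* At rate 1/2, [laplace_norm_le] has constant 4; squaring gives 16, and the factor 1/2 of the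
   kernel leaves 8. *)
apply: (@squeeze_cvgr _ _ _ _ (cst 0) (fun x => 8 * expR (- (2^-1 * x)))).
- near=> x; have x0 : 0 < x by near: x; exact: nbhs_pinfty_gt.
  have -> : expR (- (2^-1 * x)) = laplace 4^-1 x ^+ 2.
    by rewrite laplace_sqr /laplace gtr0_norm//; congr expR; field.
  have h : (laplace 2^-1 x * `|x|) ^+ 2 <= (4 * laplace 4^-1 x) ^+ 2.
    rewrite ler_sqr ?nnegrE ?mulr_ge0 ?laplace_ge0//.
    have := @laplace_norm_le R 2^-1 x; rewrite invr_gt0 ltr0n => /(_ isT).
    by congr (_ <= _ * laplace _ x); field.
  rewrite exp_kernelE mulr_ge0 ?sqr_ge0 ?mulr_ge0 ?laplace_ge0//=.
  have -> : laplace 1 x = laplace 2^-1 x ^+ 2 by rewrite laplace_sqr mulfV.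
  have xx : `|x| ^+ 2 = x ^+ 2 by rewrite gtr0_norm.
  by move: h; rewrite !exprMn xx; nra.
- exact: cvg_cst.
- rewrite -[X in _ --> X](mulr0 8); apply: cvgMl_tmp.
  apply: (cvg_comp _ _ _ (@cvgr_expR R)) => /=.
  by apply: gt0_cvgMry => //; exact: cvg_id.
Unshelve. all: by end_near. Qed.

Lemma exp_kernel_decayN : exp_kernel x * x ^+ 2 @[x --> -oo] --> (0 : R).
Proof.
apply/cvgNy_compNP; rewrite [X in X @ _](_ : _ = (fun x => exp_kernel x * x ^+ 2)).
  exact: exp_kernel_decay.
by apply/funext => x /=; rewrite sqrrN exp_kernelE laplaceN.
Qed.

(** The value at the cusp stays unspecified; the case split suffices for measurability. *)
Lemma derive1_exp_kernelE : derive1 (@exp_kernel R) = (fun x =>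
  if x == 0 then derive1 (@exp_kernel R) 0
  else if 0 < x then - exp_kernel x else exp_kernel x).
Proof.
apply/funext => x; case: eqVneq => [->//|x0].
rewrite derive1_exp_kernel//; case: (ltP 0 x) => xs.
  by rewrite gtr0_sg// mulN1r.
by rewrite ltr0_sg ?opprK ?mul1r// lt_neqAle x0.
Qed.

Lemma integrable_derive1_exp_kernel :
  leb.-integrable setT (EFin \o derive1 (@exp_kernel R)).
Proof.
have mK : measurable_fun setT (@exp_kernel R).
  by apply/measurable_EFinP; exact: measurable_int integrable_exp_kernel.
have mK' : measurable_fun setT (derive1 (@exp_kernel R)).
  rewrite derive1_exp_kernelE; apply: measurable_fun_ifT => //.
    by apply: measurable_fun_eqr.
  apply: measurable_fun_ifT => //; first exact: measurable_fun_ltr.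
  exact: measurable_funN.
apply/(@negligible_integrable _ _ _ leb setT [set (0 : R)]) => //.
- by apply/measurable_EFinP.
- exact: lebesgue_measure_set1.
have iK : leb.-integrable (setT `\` [set 0]) (EFin \o @exp_kernel R).
  by apply: integrableS integrable_exp_kernel => //; exact: measurableD.
apply: le_integrable iK => //; first exact: measurableD.
- by apply/measurable_EFinP; exact: measurable_funS mK'.
move=> x [_ /eqP x0] /=; rewrite lee_fin derive1_exp_kernel// normrM normrN.
by rewrite normr_sg x0 mul1r.
Qed.

Lemma variation_derive1_exp_kernel :
  (line_total_variation (fun x : R => `|derive1 (@exp_kernel R) x|)%R < +oo)%E.
Proof.
set c := `|derive1 (@exp_kernel R) 0|.
have c0 : 0 <= c by exact: normr_ge0.
have fE x : x != 0 -> `|derive1 (@exp_kernel R) x| = exp_kernel x.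
  move=> x0; rewrite derive1_exp_kernel// normrM normrN normr_sg x0 mul1r ger0_norm//.
  by rewrite exp_kernelE mulr_ge0 ?laplace_ge0.
(* |K'| equals K off 0, increasing on the left and decreasing on the right, hence the branches K and
   constant - K. The constants make the jumps of [m] at 0 large enough to cover the arbitrary value
   [c] there, given that K <= 1/2. *)
pose m (x : R) := if x < 0 then exp_kernel x
  else if x == 0 then 1 + c else 3 + 2 * c - exp_kernel x.
have K0 (x : R) : 0 <= exp_kernel x by rewrite exp_kernelE mulr_ge0 ?laplace_ge0.
have K1 (x : R) : exp_kernel x <= 2^-1.
  by rewrite exp_kernelE ler_piMr ?laplace_le1.
have Kmono (x y : R) : `|x| <= `|y| -> exp_kernel y <= exp_kernel x.
  by move=> xy; rewrite /exp_kernel ler_wpM2l// ler_expR lerN2.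
apply: (@le_lt_trans _ _ (3 + 2 * c)%:E); last exact: ltry.
apply: ge_ereal_sup => _ [[a b] _ <-] /=.
apply: (@le_trans _ _ (m b - m a)%:E); last first.
  rewrite lee_fin /m; have := (K0 a, K0 b, K1 a, K1 b).
  do 4?case: ifP => _; move=> [[[? ?] ?] ?]; lra.
apply: total_variation_dominated => x y xy.
have := (K0 x, K0 y, K1 x, K1 y) => -[[[Kx0 Ky0] Kx1] Ky1].
rewrite /m; have [xn|xp|x0] := ltgtP x 0; have [yn|yp|y0] := ltgtP y 0; try lra.
- have Kxy : exp_kernel x <= exp_kernel y by apply: Kmono; rewrite !ltr0_norm//; lra.
  by rewrite !fE ?lt_eqF// ger0_norm ?subr_ge0.
- by rewrite (fE _ (ltr0_neq0 xn)) (fE _ (lt0r_neq0 yp)) ler_norml; lra.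
- by rewrite y0 -/c fE ?lt_eqF// ler_norml; lra.
- have Kxy : exp_kernel y <= exp_kernel x by apply: Kmono; rewrite !gtr0_norm//; lra.
  by rewrite !fE ?gt_eqF// ler_norml; lra.
- by rewrite x0 -/c fE ?gt_eqF// ler_norml; lra.
Qed.

Lemma admissible_exp_kernel : admissible_kernel (@exp_kernel R).
Proof.
split.
- exact: integrable_exp_kernel.
- exact: Rintegral_exp_kernel.
- exists -oo%E, +oo%E; have -> : open_itv -oo%E +oo%E = [set: R].
    by apply/seteqP; split => x // _; rewrite /open_itv /= ltNyr ltry.
  split; first by rewrite ltNyr ltry.
  + congr closure; apply/seteqP; split => x // _ /=.
    by rewrite exp_kernelE mulf_neq0// gt_eqF// expR_gt0.
  + exact: lipschitz_exp_kernel.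
  + exact: piecewise_C1_exp_kernel.
- exact: integrable_exp_kernel_moment.
- exact: exp_kernel_decay.
- exact: exp_kernel_decayN.
- exact: integrable_derive1_exp_kernel.
- exact: variation_derive1_exp_kernel.
- by rewrite C1_int_exp_kernel.
Qed.

End exp_kernel_admissible.

(** * Boundedness of admissible kernels *)

Section bounded.
Context {R : realType}.
Implicit Types K : R -> R.

Lemma cvg_decay_bounded K (F : set_system R) : Filter F ->
  (\forall x \near F, 1 <= x ^+ 2) ->
  K x * x ^+ 2 @[x --> F] --> 0 -> \forall x \near F, `|K x| <= 1.
Proof.
move=> FF x1 /cvgr0Pnorm_le /(_ 1 ltr01); apply: filterS2 x1 => x x1 /=.
by apply: le_trans; rewrite normrM (ger0_norm (sqr_ge0 x)) ler_peMr.
Qed.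

(** Inside the support, the Lipschitz estimate based at 0 controls a bounded range and the decay of
    K x^2 controls the rest. This bound supplies the square integrability of [K]. *)
Lemma admissible_kernel_bounded K : admissible_kernel K -> exists M, forall x, `|K x| <= M.
Proof.
move=> [_ _ [A [B [/andP[A0 B0] AB lK _]]] _ Ky KNy _ _ _].
have [k [k0 kK]] : exists k, 0 <= k /\ forall x, open_itv A B x -> `|K x - K 0| <= k * `|x|.
  have : \forall k \near +oo, 0 <= k /\ forall p, (open_itv A B `*` open_itv A B) p ->
     `|K p.1 - K p.2| <= k * `|p.1 - p.2|.
    near=> k; split; first by near: k; exact: nbhs_pinfty_ge.
    by near: k; exact: lK.
  move=> /filter_ex[k [k0 kK]]; exists k; split => // x ABx.
  by have := kK (x, 0); rewrite /= subr0; apply; split => //; apply/andP.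
have sq1 (x : R) : 1 <= `|x| -> 1 <= x ^+ 2 by rewrite -real_normK ?num_real//; exact: exprn_ege1.
have [N1 [N1r HN1]] : \forall x \near +oo, `|K x| <= 1.
  apply: cvg_decay_bounded Ky; near=> x; apply: sq1; rewrite ler_normr.
  by apply/orP; left; near: x; exact: nbhs_pinfty_ge.
have [N2 [N2r HN2]] : \forall x \near -oo, `|K x| <= 1.
  apply: cvg_decay_bounded KNy; near=> x; apply: sq1; rewrite ler_normr.
  by apply/orP; right; rewrite lerNr; near: x; exact: nbhs_ninfty_le.
pose N := `|N1| + `|N2|.
have bU x : open_itv A B x -> `|K x| <= `|K 0| + k * N + 1.
  move=> ABx; have [xN|Nx] := leP `|x| N.
    have := ler_wpM2l k0 xN; have := kK x ABx; have := ler_normD (K x - K 0) (K 0).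
    by rewrite subrK; lra.
  have h0 : 0 <= `|K 0| + k * N by rewrite addr_ge0// mulr_ge0// addr_ge0.
  apply: (@le_trans _ _ 1); last by rewrite lerDr.
  have nN1 := normr_ge0 N1; have nN2 := normr_ge0 N2.
  have N1n := ler_norm N1; have := ler_norm (- N2); rewrite normrN => N2n.
  move: Nx; rewrite /N; have [x0|x0] := leP 0 x.
    by rewrite (ger0_norm x0) => Nx; apply: (HN1 x); lra.
  by rewrite (ltr0_norm x0) => Nx; apply: (HN2 x); lra.
(* [K] may take any value at a finite endpoint of its support, so these values are added; for an
   infinite endpoint [fine] gives 0. A point of the closure outside the open interval must be such
   an endpoint. *)
exists (`|K 0| + k * N + 1 + `|K (fine A)| + `|K (fine B)|) => x.
have h0 : 0 <= `|K 0| + k * N by rewrite addr_ge0// mulr_ge0// addr_ge0.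
have hA := normr_ge0 (K (fine A)); have hB := normr_ge0 (K (fine B)).
have [/eqP->|Kx] := boolP (K x == 0); first by rewrite normr0; lra.
have clx : closure (open_itv A B) x by rewrite -AB; exact: subset_closure.
have [Ax|xA] := ltP A x%:E; last first.
  suff -> : fine A = x by have := normr_ge0 (K x); lra.
  case: (A) AB A0 clx xA => [a| |] //= _ _ clx; rewrite lee_fin => xa.
  apply/eqP; rewrite eq_le xa andbT.
  suff : closure [set y : R | a <= y] x by rewrite -(closure_id _).1//; exact: closed_ge.
  by apply: closureS clx => y /andP[+ _]; rewrite lte_fin => /ltW.
have [xB|Bx] := ltP x%:E B; last first.
  suff -> : fine B = x by have := normr_ge0 (K x); lra.
  case: (B) AB B0 clx Bx => [b| |] //= _ _ clx; rewrite lee_fin => bx.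
  apply/eqP; rewrite eq_le bx /=.
  suff : closure [set y : R | y <= b] x by rewrite -(closure_id _).1//; exact: closed_le.
  by apply: closureS clx => y /andP[_]; rewrite lte_fin => /ltW.
by have := bU x; rewrite /open_itv/= Ax xB => /(_ isT); lra.
Unshelve. all: by end_near. Qed.

End bounded.

(** * Optimisation over the bandwidth *)

Section optimal_bandwidth.
Context {R : realType}.

(** The lower bound is a completed square divided by h. If exactly one of a and b vanishes, no h
    attains the infimum, so it is approached by near-optimal bandwidths. *)
Lemma inf_amgm (a b : R) : 0 <= a -> 0 <= b ->
  inf [set a / h + h * b | h in [set h | 0 < h]] = 2 * (Num.sqrt a * Num.sqrt b).
Proof.
move=> a0 b0; set s := Num.sqrt a; set t := Num.sqrt b.
have s0 : 0 <= s by exact: sqrtr_ge0.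
have t0 : 0 <= t by exact: sqrtr_ge0.
have -> : a = s ^+ 2 by rewrite sqr_sqrtr.
have -> : b = t ^+ 2 by rewrite sqr_sqrtr.
have lb : lbound [set s ^+ 2 / h + h * t ^+ 2 | h in [set h | 0 < h]] (2 * (s * t)).
  move=> _ [h /= h0 <-]; rewrite -subr_ge0.
  have -> : s ^+ 2 / h + h * t ^+ 2 - 2 * (s * t) = (s - h * t) ^+ 2 / h.
    by field; exact: lt0r_neq0.
  by rewrite divr_ge0 ?sqr_ge0// ltW.
apply/eqP; rewrite eq_le; apply/andP; split; last first.
  by apply: lb_le_inf => //; exists (s ^+ 2 / 1 + 1 * t ^+ 2), 1 => //=.
(* The bandwidth (s + d) / (t + d) is positive and optimal in the limit d -> 0,
   even when a or b vanishes. *)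
apply/ler_addgt0Pr => e e0; pose d := e / (s + t + 1).
have st0 : 0 < s + t + 1 by lra.
have d0 : 0 < d by exact: divr_gt0.
have sd0 : 0 < s + d by lra.
have td0 : 0 < t + d by lra.
apply: (@le_trans _ _ (s ^+ 2 / ((s + d) / (t + d)) + (s + d) / (t + d) * t ^+ 2)).
  apply: ge_inf; first by exists (2 * (s * t)).
  by exists ((s + d) / (t + d)) => //=; exact: divr_gt0.
have ub (x y : R) : 0 <= x -> 0 < x + d -> 0 <= y -> x ^+ 2 * (y + d) / (x + d) <= x * (y + d).
  move=> x0 xd y0; rewrite ler_pdivrMr// expr2 -!mulrA ler_wpM2l//.
  by rewrite mulrC ler_wpM2l//; lra.
have -> : s ^+ 2 / ((s + d) / (t + d)) + (s + d) / (t + d) * t ^+ 2 =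
    s ^+ 2 * (t + d) / (s + d) + t ^+ 2 * (s + d) / (t + d).
  by field; rewrite !lt0r_neq0.
apply: (@le_trans _ _ (2 * (s * t) + d * (s + t))).
  by have := ub s t s0 sd0 t0; have := ub t s t0 td0 s0; lra.
(* The choice of [d] makes d (s + t) <= e; the summand 1 in its denominator covers s = t = 0. *)
rewrite lerD2l /d -mulrAC ler_pdivrMr// ler_wpM2l//; lra.
Qed.

End optimal_bandwidth.

(** * Comparison of the optimal errors *)

(** Reduces the comparison of two kernels to that of their products [sq_int * C1_int], the factors c
    and l being common to both. *)
Lemma ler_mul_sqrt (R : realType) (c l x y x' y' : R) : 0 <= c -> 0 <= l ->
  0 <= x -> 0 <= x' -> 0 <= y' -> x * y <= x' * y' ->
  Num.sqrt (c * x) * Num.sqrt (l * y) <= Num.sqrt (c * x') * Num.sqrt (l * y').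
Proof.
move=> c0 l0 x0 x'0 y'0 xy; rewrite -!sqrtrM ?mulr_ge0//.
by rewrite ler_sqrt ?mulr_ge0// ![_ * _ * (l * _)]mulrACA ler_wpM2l ?mulr_ge0.
Qed.

Section mse.
Context {R : realType} {d : measure_display} {Omega : measurableType d}.
Variables (P : probability Omega R) (sigma : R -> Omega -> R) (L : R -> R).

Lemma sigma4_mean_ge0 tau : 0 <= sigma4_mean P sigma tau.
Proof.
apply/fine_ge0/expectation_ge0 => w.
by rewrite exprn_even_ge0.
Qed.

Lemma sq_int_ge0 (K : R -> R) : 0 <= sq_int K.
Proof. by apply: Rintegral_ge0 => x _; exact: sqr_ge0. Qed.

Lemma mse_a_optE (T tau : R) (n : nat) (K : R -> R) : 0 <= T -> 0 <= L tau * C1_int K ->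
  mse_a_opt P sigma L T n tau K = 2 * (Num.sqrt n%:R)^-1
    * Num.sqrt (2 * T * sigma4_mean P sigma tau * sq_int K)
    * Num.sqrt (L tau * C1_int K).
Proof.
move=> T0 LC0; set c := 2 * T * sigma4_mean P sigma tau * sq_int K.
have c0 : 0 <= c by rewrite !mulr_ge0 ?sigma4_mean_ge0 ?sq_int_ge0.
transitivity (2 * (Num.sqrt (c / n%:R) * Num.sqrt (L tau * C1_int K))).
  rewrite -inf_amgm ?divr_ge0//; congr inf; congr image; apply/funext => h.
  by rewrite /mse_a mulrA /c; congr (_ + _); ring.
rewrite sqrtrM// sqrtrV//; ring.
Qed.

End mse.

Theorem theorem4p1 (R : realType) (d : measure_display)
    (Omega : measurableType d) (P : probability Omega R)
    (F : R -> set (set Omega)) (mu sigma B X : R -> Omega -> R)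
    (T tau : R) (n : nat) (L : R -> R)
    (hF : complete_filtration P F)
    (hmu : adapted F mu) (hsigma : adapted F sigma)
    (hB : brownian_motion P F B)
    (hX : ito_process P F T B mu sigma X)
    (hindep : non_leverage P mu sigma B)
    (hmoment : moment_bound P T mu sigma)
    (hscaling : scaling_condition P T sigma L)
    (htau : 0 < tau < T) (hn : (0 < n)%N) :
  (forall K : R -> R, admissible_kernel K ->
     mse_a_opt P sigma L T n tau K =
     2 * (Num.sqrt n%:R)^-1
       * Num.sqrt (2 * T * sigma4_mean P sigma tau * sq_int K)
       * Num.sqrt (L tau * C1_int K)) /\
  admissible_kernel (@exp_kernel R) /\
  (forall K : R -> R, admissible_kernel K ->
     mse_a_opt P sigma L T n tau (@exp_kernel R)
       <= mse_a_opt P sigma L T n tau K).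
Proof.
have T0 : 0 < T by case/andP: htau; exact: lt_trans.
have L0 : 0 <= L tau by case: hscaling => + _; exact.
have formula K : admissible_kernel K -> mse_a_opt P sigma L T n tau K =
    2 * (Num.sqrt n%:R)^-1
      * Num.sqrt (2 * T * sigma4_mean P sigma tau * sq_int K)
      * Num.sqrt (L tau * C1_int K).
  move=> aK; apply: mse_a_optE; first exact: ltW.
  by rewrite mulr_ge0// ltW// ak_C1_int_gt0.
have adm := @admissible_exp_kernel R.
split; [exact: formula|split=> [|K aK]]; first exact: adm.
have [M bK] := admissible_kernel_bounded aK.
have C0 := ak_C1_int_gt0 aK.
rewrite (formula _ adm) (formula _ aK) -[leLHS]mulrA -[leRHS]mulrA.
apply: ler_wpM2l; first by rewrite mulr_ge0// invr_ge0 sqrtr_ge0.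
apply: ler_mul_sqrt => //.
- by apply: mulr_ge0; [apply: mulr_ge0 => //; exact: ltW|exact: sigma4_mean_ge0].
- exact: sq_int_ge0.
- exact: sq_int_ge0.
- exact: ltW.
(* The product for the exponential kernel is exactly the universal lower bound 1/16. *)
rewrite sq_int_exp_kernel C1_int_exp_kernel.
have -> : (4^-1 * 4^-1 : R) = 16^-1 by field.
exact: sq_int_C1_int_ge (ak_integrable aK) (ak_moment aK) bK (ak_mass aK) C0.
Qed.
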